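(* Let $(X,\|\cdot\|)$ be uniformly convex with modulus $\eta$. Let $(x_n),(y_n)$ be the sequences generated by the stochastic Halpern-Mann iteration $$y_n:=(1-\alpha_n)(Tx_n+\xi_n)+\alpha_nu,\qquad x_{n+1}:=(1-\beta_n)(Uy_n+\delta_n)+\beta_ny_n .$$ Let $p\in X$ be a common fixed point of $T$ and $U$, let $K_0$ satisfy $K_0\ge\mathbb{E}[\|x_0-p\|]$ and $K_0\ge\mathbb{E}[\|u-p\|]$, let $D\ge\sum_{n=0}^\infty\mathbb{E}[\|\delta_n\|]$ and $E\ge\sum_{n=0}^\infty\mathbb{E}[\|\xi_n\|]$, and put $K:=4K_0+2D+2E$. Let $\|x_{n+1}-x_n\|\to0$ almost surely with rate $\Delta$. Also, let $\rho$ be a rate for $\alpha_n\to0$ and assume that $\sum_{n=0}^\infty\mathbb{E}[\|\xi_n\|]<\infty$ and $\sum_{n=0}^\infty\mathbb{E}[\|\delta_n\|]<\infty$ with rates of convergence $\chi_1$ and $\chi_2$, respectively. Lastly, let $\Lambda>0$ be such that $\Lambda\le\beta_n\le1-\Lambda$ for all $n\in\mathbb{N}$. Then $\|Uy_n-y_n\|\to0$ almost surely with rate $$\Gamma(\lambda,\varepsilon):=\max\left\{\Delta\left(\tfrac{\lambda}{9},\tfrac{\widehat\varepsilon}{4}\right),\rho\left(\tfrac{\widehat\varepsilon}{4K'}\right),\chi_1\left(\tfrac{\lambda\widehat\varepsilon}{36}\right),\chi_2\left(\tfrac{\lambda\widehat\varepsilon}{36}\right)\right\}$$ for $\widehat\varepsilon:=\varepsilon\cdot\Lambda^2\cdot\eta(\varepsilon/K')$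 and $K':=3K/\lambda$.
   Context: $\mathbb{N}=\{0,1,2,\dots\}$. $(\Omega,\mathcal{F},\mathbb{P})$ is a probability space, $(X,\|\cdot\|)$ is a separable real normed space, and an $X$-valued random variable is a measurable function $\Omega\to X$. $T,U:X\to X$ are nonexpansive ($\|Tx-Ty\|\le\|x-y\|$, $\|Ux-Uy\|\le\|x-y\|$ for all $x,y\in X$); $x_0$ (the starting point) and $u$ (the anchor) are $X$-valued random variables; $(\xi_n),(\delta_n)$ are sequences of $X$-valued random variables; $(\alpha_n),(\beta_n)\subseteq[0,1]$ are nonstochastic. $X$ is uniformly convex if for any $\varepsilon\in(0,2]$ there exists a $\delta\in(0,1]$ such that for all $x,y$ in the closed unit ball, $\|x-y\|\ge\varepsilon$ implies $\|\frac{x+y}{2}\|\le1-\delta$; a modulus of uniform convexity for $X$ is a function $\eta:(0,2]\to(0,1]$ giving such a $\delta=\eta(\varepsilon)$ in terms of $\varepsilon$. Rates. For nonnegative reals $(a_n)$: a rate for $a_n\to0$ is a function $\varphi:(0,\infty)\to\mathbb{N}$ with $a_n<\varepsilon$ for all $\varepsilon>0$ and $n\ge\varphi(\varepsilon)$; a rate of convergence for $\sum_{n=0}^\infty a_n<\infty$ is a function $\chi:(0,\infty)\to\mathbb{N}$ with $\sum_{n=\chi(\varepsilon)}^\infty a_n<\varepsilon$ for all $\varepsilon>0$. For nonnegative random variables $(X_n)$: a rate for $X_n\to0$ almost surely is a function $\Phi:(0,\infty)^2\to\mathbb{N}$ with $\mathbb{P}(\exists n\ge\Phi(\lambda,\varepsilon)\,(X_n\ge\varepsilon))<\lambda$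 for all $\lambda,\varepsilon>0$. *)

(* Defs.v *)
From HB Require Import structures.
From mathcomp Require Import all_boot all_order all_algebra.
From mathcomp Require Import all_classical all_reals all_analysis.

Set Implicit Arguments.
Unset Strict Implicit.
Unset Printing Implicit Defensive.

Import Order.TTheory GRing.Theory Num.Theory.
Import numFieldNormedType.Exports.

Local Open Scope classical_set_scope.
Local Open Scope ring_scope.

Definition separable (X : topologicalType) : Prop :=
  exists2 S : set X, countable S & dense S.

(* X is equipped with its Borel sigma-algebra. *)
Definition is_random_variable (d : measure_display) (Omega : measurableType d)
    (R : realType) (X : normedModType R) (f : Omega -> X) : Prop :=
  measurable_fun [set: Omega] (f : Omega -> g_sigma_algebraType (@open X)).

Definition nonexpansive (R : realType) (X : normedModType R) (T : X -> X) :
    Prop :=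
  forall x y : X, `|T x - T y| <= `|x - y|.

(* A modulus is a function ]0, 2] -> ]0, 1]; it is represented by a function
   on R that is unconstrained outside ]0, 2]. *)
Definition modulus_of_uniform_convexity (R : realType) (X : normedModType R)
    (eta : R -> R) : Prop :=
  forall eps : R, 0 < eps <= 2 ->
    0 < eta eps <= 1 /\
    forall x y : X, `|x| <= 1 -> `|y| <= 1 -> eps <= `|x - y| ->
      `|2^-1 *: (x + y)| <= 1 - eta eps.

(* In the following three definitions, rates are functions on ]0, +oo[ (resp.
   its square), represented by functions on R (resp. R x R) whose values
   elsewhere are unconstrained. *)
Definition rate_to0 (R : realType) (a : nat -> R) (phi : R -> nat) : Prop :=
  forall (eps : R) (n : nat), 0 < eps -> (phi eps <= n)%N -> a n < eps.

(* The summands are extended reals so as to apply to expectations. *)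
Definition rate_summable (R : realType) (a : nat -> \bar R) (chi : R -> nat) :
    Prop :=
  forall eps : R, 0 < eps -> (\sum_(chi eps <= n <oo) a n < eps%:E)%E.

Definition rate_as_to0 (d : measure_display) (Omega : measurableType d)
    (R : realType) (P : probability Omega R) (Z : nat -> Omega -> R)
    (Phi : R -> R -> nat) : Prop :=
  forall lambda eps : R, 0 < lambda -> 0 < eps ->
    (P [set w | exists n : nat, (Phi lambda eps <= n)%N /\ (eps <= Z n w)%R]
      < lambda%:E)%E.

(* Main.v *)
Require Import Defs.
From HB Require Import structures.
From mathcomp Require Import all_boot all_order all_algebra.
From mathcomp Require Import all_classical all_reals all_analysis.
From mathcomp Require Import measurable_realfun.
From mathcomp Require Import lra.

Set Implicit Arguments.
Unset Strict Implicit.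
Unset Printing Implicit Defensive.

Import Order.TTheory GRing.Theory Num.Theory.
Import numFieldNormedType.Exports.

Local Open Scope classical_set_scope.
Local Open Scope ring_scope.

(** Write the step as [x (n+1) - p = (1 - beta) (U y - p) + beta (y - p) +
(1 - beta) delta], with both [|U y - p|] and [|y - p|] at most [r := |y - p|].
If [|U y - y| >= eps], uniform convexity makes the convex combination shorter
than [r] by a definite amount ([convex_combination_norm_le]); here the bounds
[Lambda <= beta <= 1 - Lambda] keep it away from its end points.  On the other
hand, [y n] is the point [x n] up to the noise [xi n], the anchor term of
weight [alpha n] and an application of [T], which does not increase the distance
to [p], so that [r] exceeds [|x (n+1) - p|] by at most [|x (n+1) - x n|] plus
small terms.  Once these are all below [eps_hat / 4] the two estimates
contradict each other ([residual_lt]).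

This pathwise argument needs an a priori bound on [|y n - p|] and [|u - p|],
uniform in [n].  The random variable
[|x0 - p| + |u - p| + sum |xi| + sum |delta|] ([envelope]) is such a bound, and
its expectation is at most [K / 2], so that by Markov's inequality it is at
least [K' = 3 K / lambda] with probability at most [lambda / 6].  Markov's
inequality also bounds by [lambda / 9] the probability that a tail of one of the
two noise series, hence one of its terms, is large; the increments of [x]
contribute another [lambda / 9].  The sum of these probabilities is
[lambda / 2].  When [K < lambda * eps], [eps / K'] may lie outside the domain of
the modulus, but then [|U y - y| <= 2 |y - p|] and Markov's inequality for the
envelope conclude at once.

The probability of an event is only controlled if the event is measurable, so
the iterates must be shown to be random variables.  This is where
separability enters: it makes jointly continuous functions of two random
variables measurable ([random_variable_continuous2]). *)

(** * Random variables in a separable normed space *)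

Lemma nonexpansive_continuous (R : realType) (X : normedModType R) (S : X -> X) :
  nonexpansive S -> continuous S.
Proof.
move=> nS z; apply/cvgrPdist_lt => e e0; near=> t.
apply: le_lt_trans (nS z t) _; near: t.
by have := nbhsx_ballx z e e0; rewrite -ball_normE.
Unshelve. all: by end_near. Qed.

Section random_variables.
Context (d : measure_display) (Omega : measurableType d) (R : realType).
Context (X : normedModType R).

Lemma random_variable_openP (f : Omega -> X) :
  is_random_variable f <-> forall A : set X, open A -> measurable (f @^-1` A).
Proof.
split=> [mf A oA|mf].
  by rewrite -[_ @^-1` _]setTI; apply: mf => //; exact: sub_gen_smallest.
apply: (@measurability _ _ _ (g_sigma_algebraType (@open X)) _ _ (@open X)) => //.
by move=> _ [A oA <-]; rewrite setTI; exact: mf.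
Qed.

Lemma random_variable_cst (z : X) : is_random_variable (fun _ : Omega => z).
Proof. exact: measurable_cst. Qed.

Lemma random_variable_comp (S : X -> X) (f : Omega -> X) : continuous S ->
  is_random_variable f -> is_random_variable (fun w => S (f w)).
Proof.
move=> /continuousP cS /random_variable_openP mf.
by apply/random_variable_openP => A oA; apply: (mf (S @^-1` A)); exact: cS.
Qed.

Lemma random_variable_norm (f : Omega -> X) :
  is_random_variable f -> measurable_fun setT (fun w => `|f w|).
Proof.
move=> /random_variable_openP mf.
apply: (@measurability _ _ _ _ _ _ _ (RGenOInfty.measurableE R)).
move=> _ [_ [a ->] <-]; rewrite setTI.
have oA : open ((fun z : X => `|z|) @^-1` `]a, +oo[%classic).
  move/continuousP: (@norm_continuous _ X); apply; exact: interval_open.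
exact: mf _ oA.
Qed.

Hypothesis X_separable : separable X.

(** The Borel sigma-algebra of [X * X] is the product one when [X] is separable:
the preimage of an open set under [h] is a countable union of rectangles
whose sides are balls centred in the dense sequence [s], with radii [1/(k+1)];
[good] singles out the rectangles that [h] maps into the open set. *)
Lemma random_variable_continuous2 (h : X -> X -> X) (f g : Omega -> X) :
  continuous (fun z : X * X => h z.1 z.2) ->
  is_random_variable f -> is_random_variable g ->
  is_random_variable (fun w => h (f w) (g w)).
Proof.
move=> ch /random_variable_openP mf /random_variable_openP mg.
apply/random_variable_openP => A oA.
have [S cS dS] := X_separable.
have /pcard_surjP[s sS] := cS.
pose e (k : nat) : R := k.+1%:R^-1.
have e_gt0 k : 0 < e k by rewrite invr_gt0.
pose good (q : nat * nat * nat) :=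
  forall a b : X, ball (s q.1.1) (e q.2) a -> ball (s q.1.2) (e q.2) b ->
  A (h a b).
pose F (q : nat * nat * nat) : set Omega :=
  if `[< good q >] then
    f @^-1` ball (s q.1.1) (e q.2) `&` g @^-1` ball (s q.1.2) (e q.2)
  else set0.
have -> : (fun w => h (f w) (g w)) @^-1` A = \bigcup_q F q.
  apply/seteqP; split=> [w Aw|w [q _]]; last first.
    by rewrite /F; case: asboolP => // gq [fw gw]; exact: gq.
  have nA : nbhs (h (f w) (g w)) A by exact: open_nbhs_nbhs.
  have := ch (f w, g w) A nA.
  case=> -[/= B C] [/nbhs_ballP[r1 /= r1_gt0 rB] /nbhs_ballP[r2 /= r2_gt0 rC]] BC.
  pose r := Num.min r1 r2.
  have r_gt0 : 0 < r by rewrite lt_min r1_gt0.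
  have [k ek] : exists k, e k < r / 2.
    have [k _ kr] := near_infty_natSinv_lt (PosNum (divr_gt0 r_gt0 (ltr0Sn R 1))).
    by exists k; exact: (kr k (leqnn _)).
  have approx z : exists i, ball (s i) (e k) z.
    have [t [zt St]] : ball z (e k) `&` S !=set0.
      by apply: dS; [exists z; exact: ballxx|exact: ball_open].
    have [i _ st] := sS _ St.
    by exists i; rewrite st; exact: ball_sym.
  have [i fi] := approx (f w); have [j gj] := approx (g w).
  exists (i, j, k) => //; rewrite /F; case: asboolP => //=.
  case=> a b /= ia jb.
  have close z t c : ball (s t) (e k) z -> ball (s t) (e k) c -> ball z r c.
    by move=> tz tc; rewrite (splitr r); apply: ball_triangle;
      [exact: (ball_sym (le_ball (ltW ek) tz))|exact: (le_ball (ltW ek) tc)].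
  apply: (BC (a, b)); split=> /=.
    apply: rB; apply: (@le_ball _ _ _ r); first by rewrite ge_min lexx.
    exact: close fi ia.
  apply: rC; apply: (@le_ball _ _ _ r); first by rewrite ge_min lexx orbT.
  exact: close gj jb.
apply: countable_bigcupT_measurable => // q; rewrite /F.
case: ifP => // _; apply: measurableI.
  by apply: mf; exact: ball_open.
by apply: mg; exact: ball_open.
Qed.

Lemma random_variable_lincomb (s t : R) (f g : Omega -> X) :
  is_random_variable f -> is_random_variable g ->
  is_random_variable (fun w => s *: f w + t *: g w).
Proof.
apply: (random_variable_continuous2 (h := fun a b => s *: a + t *: b)) => z.
by apply: cvgD; apply: cvgZr; [exact: cvg_fst|exact: cvg_snd].
Qed.

Lemma random_variableD (f g : Omega -> X) : is_random_variable f ->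
  is_random_variable g -> is_random_variable (fun w => f w + g w).
Proof.
move=> rf rg; have := random_variable_lincomb 1 1 rf rg.
by congr is_random_variable; apply: funext => w; rewrite !scale1r.
Qed.

Lemma random_variableB (f g : Omega -> X) : is_random_variable f ->
  is_random_variable g -> is_random_variable (fun w => f w - g w).
Proof.
move=> rf rg; have := random_variable_lincomb 1 (-1) rf rg.
by congr is_random_variable; apply: funext => w; rewrite scale1r scaleN1r.
Qed.

End random_variables.

(** * Uniform convexity *)

Section uniform_convexity.
Context (R : realType) (X : normedModType R) (eta : R -> R).
Hypothesis X_uc : modulus_of_uniform_convexity X eta.

Lemma midpoint_norm_le (eps r : R) (a b : X) : 0 < eps <= 2 -> 0 < r ->
  `|a| <= r -> `|b| <= r -> eps * r <= `|a - b| ->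
  `|2^-1 *: (a + b)| <= (1 - eta eps) * r.
Proof.
move=> eps02 r_gt0 ar br abr; have [_ uc] := X_uc eps02.
have nrm (z : X) : `|r^-1 *: z| = `|z| / r.
  by rewrite normrZ gtr0_norm ?invr_gt0// mulrC.
have := uc (r^-1 *: a) (r^-1 *: b).
rewrite -scalerBr -scalerDr scalerA mulrC -scalerA !nrm.
by rewrite !ler_pdivrMr// mul1r ler_pdivlMr//; apply.
Qed.

(** A convex combination with weight [t <= 1/2] on [b] is a combination of [a] and
the midpoint with weight [2 * t] on the midpoint; only the latter gains. *)
Lemma convex_combination_norm_le (eps r L t : R) (a b : X) :
  0 < eps <= 2 -> 0 < r -> `|a| <= r -> `|b| <= r -> eps * r <= `|a - b| ->
  L <= t <= 1 - L -> 0 < L ->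
  `|(1 - t) *: a + t *: b| <= (1 - 2 * L * eta eps) * r.
Proof.
move=> eps02 r_gt0.
wlog t_half : a b t / t <= 2^-1 => [wl ar br abr /andP[Lt tL] L0|].
  have [t_half|t_half] := leP t 2^-1; first by apply: wl => //; rewrite Lt.
  have := wl b a (1 - t); rewrite subKr [t *: b + _]addrC [`|b - a|]distrC.
  by apply=> //; lra.
move=> ar br abr /andP[Lt tL] L_gt0.
have [/andP[eta_gt0 _] _] := X_uc eps02.
have -> : (1 - t) *: a + t *: b =
    (1 - 2 * t) *: a + (2 * t) *: (2^-1 *: (a + b)).
  rewrite scalerA mulrAC divff// mul1r scalerDr addrA -scalerDl.
  by congr (_ *: _ + _); lra.
have mid := midpoint_norm_le eps02 r_gt0 ar br abr.
move: (2^-1 *: (a + b)) mid => m mid.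
apply: le_trans (ler_normD _ _) _; rewrite !normrZ !ger0_norm; try lra.
have h1 : (1 - 2 * t) * `|a| <= (1 - 2 * t) * r by rewrite ler_wpM2l//; lra.
have h2 : 2 * t * `|m| <= 2 * t * ((1 - eta eps) * r).
  by rewrite ler_wpM2l//; lra.
have h3 : L * (eta eps * r) <= t * (eta eps * r).
  by rewrite ler_wpM2r// ltW// mulr_gt0.
lra.
Qed.

End uniform_convexity.

(** * Pathwise estimates for the Halpern-Mann iteration *)

Section halpern_mann.
Context (R : realType) (X : normedModType R).
Variables (T U : X -> X) (p : X).
Hypotheses (T_nonexpansive : nonexpansive T) (U_nonexpansive : nonexpansive U).
Hypotheses (T_fix : T p = p) (U_fix : U p = p).
Variables (alpha beta : nat -> R) (u : X) (xi delta x y : nat -> X).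
Hypothesis alpha01 : forall n, 0 <= alpha n <= 1.
Hypothesis beta01 : forall n, 0 <= beta n <= 1.
Hypothesis y_def : forall n,
  y n = (1 - alpha n) *: (T (x n) + xi n) + alpha n *: u.
Hypothesis x_step : forall n,
  x n.+1 = (1 - beta n) *: (U (y n) + delta n) + beta n *: y n.

Lemma convex_combinationBr (t : R) (a b c : X) :
  (1 - t) *: a + t *: b - c = (1 - t) *: (a - c) + t *: (b - c).
Proof.
by rewrite !scalerBr addrACA -opprD -scalerDl subrK scale1r.
Qed.

Lemma nonexpansive_fix_le (S : X -> X) (z : X) :
  nonexpansive S -> S p = p -> `|S z - p| <= `|z - p|.
Proof. by move=> /(_ z p) + Sp; rewrite Sp. Qed.

Lemma anchored_step_le n :
  `|y n - p| <= (1 - alpha n) * (`|x n - p| + `|xi n|) + alpha n * `|u - p|.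
Proof.
have /andP[a0 a1] := alpha01 n.
rewrite y_def convex_combinationBr; apply: le_trans (ler_normD _ _) _.
rewrite !normrZ !ger0_norm ?subr_ge0// lerD2r ler_wpM2l ?subr_ge0//.
rewrite addrAC; apply: le_trans (ler_normD _ _) _; rewrite lerD2r.
exact: nonexpansive_fix_le.
Qed.

Lemma mann_step_le n : `|x n.+1 - p| <= `|y n - p| + `|delta n|.
Proof.
have /andP[b0 b1] := beta01 n.
rewrite x_step convex_combinationBr; apply: le_trans (ler_normD _ _) _.
rewrite !normrZ !ger0_norm ?subr_ge0//.
have h : `|U (y n) + delta n - p| <= `|y n - p| + `|delta n|.
  rewrite addrAC; apply: le_trans (ler_normD _ _) _; rewrite lerD2r.
  exact: nonexpansive_fix_le.
have h' := ler_wpM2l (_ : 0 <= 1 - beta n) h.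
have := h' ltac:(lra); have := mulr_ge0 b0 (normr_ge0 (delta n)).
lra.
Qed.

(** Each half-step takes a convex combination of points within the current bound,
after adding one noise term; so the bound grows by the noise only. *)
Lemma iterates_bounded (B : R) n : `|x 0 - p| <= B -> `|u - p| <= B ->
  `|x n - p| <= B + \sum_(i < n) `|xi i| + \sum_(i < n) `|delta i| /\
  `|y n - p| <= B + \sum_(i < n.+1) `|xi i| + \sum_(i < n) `|delta i|.
Proof.
move=> x0B uB.
have yB m (c : R) : 0 <= c -> `|x m - p| <= B + c ->
    `|y m - p| <= B + c + `|xi m|.
  move=> c0 xm; apply: le_trans (anchored_step_le m) _.
  have /andP[a0 a1] := alpha01 m.
  have h1 : (1 - alpha m) * (`|x m - p| + `|xi m|) <=
      (1 - alpha m) * (B + c + `|xi m|) by rewrite ler_wpM2l ?subr_ge0// lerD2r.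
  have h2 : alpha m * `|u - p| <= alpha m * (B + c + `|xi m|).
    by rewrite ler_wpM2l//; have := normr_ge0 (xi m); lra.
  lra.
have sum0 (z : nat -> X) m : 0 <= \sum_(i < m) `|z i| by exact: sumr_ge0.
suff xB : `|x n - p| <= B + \sum_(i < n) `|xi i| + \sum_(i < n) `|delta i|.
  split=> //; rewrite big_ord_recr/=.
  have := yB n _ (addr_ge0 (sum0 xi n) (sum0 delta n)).
  by rewrite !addrA [_ + _ + `|xi n|]addrAC; apply.
elim: n => [|n xB]; first by rewrite !big_ord0 !addr0.
apply: le_trans (mann_step_le n) _; rewrite !big_ord_recr/=.
have := yB n _ (addr_ge0 (sum0 xi n) (sum0 delta n)).
by rewrite addrA => /(_ xB); lra.
Qed.

(** If the residual were at least [eps], uniform convexity at scale [|y n - p|]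
would make [|x n.+1 - p|] smaller than [|y n - p|] by [2 * e], up to [e / 4],
while the small increment, noise and anchor weight allow a drop of at most
[3 * (e / 4)].  As no monotonicity of the modulus is assumed, it is evaluated at
the fixed [eps / C], which is at most [eps / |y n - p|]. *)
Lemma residual_lt (eta : R -> R) (L eps C e : R) n :
  modulus_of_uniform_convexity X eta ->
  0 < L -> L <= beta n <= 1 - L ->
  0 < eps -> 0 < C -> eps / C <= 2 -> `|y n - p| <= C -> `|u - p| <= C ->
  e = eps * L ^+ 2 * eta (eps / C) ->
  `|x n.+1 - x n| < e / 4 -> alpha n < e / (4 * C) ->
  `|xi n| < e / 4 -> `|delta n| < e / 4 ->
  `|U (y n) - y n| < eps.
Proof.
move=> uc L0 bL eps0 C0 epsC yC uC eE dx al xie de; rewrite ltNge; apply/negP => epsU.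
have epsC02 : 0 < eps / C <= 2 by rewrite epsC divr_gt0.
have [/andP[eta0 eta1] _] := uc _ epsC02.
have Ur := nonexpansive_fix_le (y n) U_nonexpansive U_fix.
set r := `|y n - p| in yC Ur.
have Uyr : `|U (y n) - y n| <= 2 * r.
  rewrite -[U (y n) - y n](subrKA p) -[p - y n]opprB.
  by apply: le_trans (ler_normB _ _) _; rewrite mulr2n mulrDl mul1r lerD2r.
have r0 : 0 < r by lra.
have conv : `|(1 - beta n) *: (U (y n) - p) + beta n *: (y n - p)| <=
    (1 - 2 * L * eta (eps / C)) * r.
  apply: convex_combination_norm_le => //.
  rewrite opprB addrA subrK; apply: le_trans epsU.
  by rewrite mulrAC ler_pdivrMr// ler_wpM2l// ltW.
have xr : `|x n.+1 - p| <= (1 - 2 * L * eta (eps / C)) * r + `|delta n|.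
  rewrite x_step convex_combinationBr [_ + delta n - p]addrAC.
  rewrite [_ *: (_ + delta n)]scalerDr addrAC.
  apply: le_trans (ler_normD _ _) _; apply: lerD => //.
  case/andP: bL => bL1 bL2; rewrite normrZ ger0_norm ?subr_ge0; last lra.
  by rewrite -[leRHS]mul1r ler_wpM2r//; lra.
have xx : `|x n - p| <= `|x n.+1 - p| + `|x n.+1 - x n|.
  have -> : x n - p = (x n.+1 - p) - (x n.+1 - x n).
    by rewrite opprB [RHS]addrC addrA subrK.
  exact: ler_normB.
have yr := anchored_step_le n.
have /andP[a0 a1] := alpha01 n.
have au : alpha n * `|u - p| <= e / 4.
  have h1 : alpha n * `|u - p| <= alpha n * C by rewrite ler_wpM2l.
  apply: le_trans h1 _; have := ltW al.
  by rewrite invfM mulrA ler_pdivlMr.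
have a3 : 0 <= alpha n * (`|x n - p| + `|xi n|) by rewrite mulr_ge0// addr_ge0.
(* [L <= 1/2] turns the gain [2 * L * eta * r >= L * eta * eps] into at least [2 * e] *)
have gain : 2 * e <= 2 * L * eta (eps / C) * r.
  have Lh : L <= 2^-1 by case/andP: bL => *; lra.
  have le0 : 0 < L * eta (eps / C) by rewrite mulr_gt0.
  have g1 : L * eta (eps / C) * eps <= L * eta (eps / C) * (2 * r).
    by rewrite ler_wpM2l ?(ltW le0)//; lra.
  have g2 : L * (L * eta (eps / C) * eps) <= 2^-1 * (L * eta (eps / C) * eps).
    by rewrite ler_wpM2r// ltW// mulr_gt0.
  rewrite eE expr2; lra.
have e0 : 0 < e by rewrite eE !mulr_gt0// exprn_gt0.
rewrite -/r in yr; lra.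
Qed.

End halpern_mann.

(** * Markov bounds for norms of random variables *)

Section probability_bounds.
Context (d : measure_display) (Omega : measurableType d) (R : realType).
Context (P : probability Omega R).

Lemma measurable_eventually_ge (Z : nat -> Omega -> R) (N : nat) (e : R) :
  (forall n, measurable_fun setT (Z n)) ->
  measurable [set w | exists n : nat, (N <= n)%N /\ e <= Z n w].
Proof.
move=> mZ.
have -> : [set w | exists n : nat, (N <= n)%N /\ e <= Z n w] =
    \bigcup_(n in [set n | (N <= n)%N]) (setT `&` Z n @^-1` `[e, +oo[).
  apply/seteqP; split=> [w [n [Nn eZ]]|w [n Nn [_ /=]]].
    by exists n => //; split=> //=; rewrite in_itv/= eZ.
  by rewrite in_itv/= andbT => eZ; exists n.
by apply: bigcup_measurable => n _; exact: mZ.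
Qed.

Local Open Scope ereal_scope.

Lemma measurable_ereal_ge (f : Omega -> \bar R) (c : \bar R) :
  measurable_fun setT f -> measurable [set w | c <= f w].
Proof.
move=> mf; rewrite -[X in measurable X]setTI.
exact: emeasurable_fun_c_infty.
Qed.

(** Stated for extended reals because a series of norms may be infinite at
some points. *)
Lemma markov_le (f : Omega -> \bar R) (c I : R) :
  measurable_fun setT f -> (forall w, 0 <= f w) -> (0 < c)%R ->
  \int[P]_w f w <= I%:E -> P [set w | c%:E <= f w] <= (I / c)%:E.
Proof.
move=> mf f0 c0 fI.
have PA : c%:E * P [set w | c%:E <= f w] <= I%:E.
  apply: le_trans fI; rewrite -[X in P X]setTI.
  rewrite -(eq_integral _ _ (fun w _ => gee0_abs (f0 w))).
  under eq_set do rewrite -(gee0_abs (f0 _)).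
  by apply: (@le_integral_comp_abse _ _ _ P _ measurableT f c id).
have PAfin : P [set w | c%:E <= f w] \is a fin_num.
  by apply: fin_num_measure; exact: measurable_ereal_ge.
move: PA; rewrite -(fineK PAfin) -EFinM !lee_fin.
by rewrite ler_pdivlMr// mulrC.
Qed.

Context (X : normedModType R).
Implicit Types z : nat -> Omega -> X.

Definition norm_tail (z : nat -> Omega -> X) (N : nat) (w : Omega) : \bar R :=
  \sum_(N <= n <oo) `|z n w|%:E.

Lemma norm_tail_ge0 z N w : 0 <= norm_tail z N w.
Proof. by apply: nneseries_ge0 => n _ _; rewrite lee_fin. Qed.

Lemma norm_tail_ge z N n w : (N <= n)%N -> `|z n w|%:E <= norm_tail z N w.
Proof.
move=> Nn; apply: (@le_trans _ _ (\sum_(N <= i < n.+1) `|z i w|%:E)); last first.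
  by apply: nneseries_lim_ge => i _ _; rewrite lee_fin.
by rewrite big_nat_recr//= leeDr// sume_ge0// => i _; rewrite lee_fin.
Qed.

Lemma norm_tail_ge_sum z n w : (\sum_(i < n) `|z i w|)%:E <= norm_tail z 0 w.
Proof.
rewrite -sumEFin -(big_mkord xpredT (fun i => `|z i w|%:E)).
by apply: nneseries_lim_ge => i _ _; rewrite lee_fin.
Qed.

Lemma measurable_norm_tail z N :
  (forall n, is_random_variable (z n)) -> measurable_fun setT (norm_tail z N).
Proof.
move=> mz; rewrite /norm_tail.
under eq_fun do rewrite -nneseries_addn ?lee_fin//.
apply: (@ge0_emeasurable_sum _ _ _ _ (fun i w => `|z (i + N)%N w|%:E) xpredT).
  by move=> k w _ _; rewrite lee_fin.
by move=> k _; apply/measurable_EFinP; exact: random_variable_norm.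
Qed.

Lemma integral_norm_tail z N : (forall n, is_random_variable (z n)) ->
  \int[P]_w norm_tail z N w = \sum_(N <= n <oo) 'E_P[fun w => `|z n w|%R].
Proof.
move=> mz; rewrite /norm_tail.
under eq_integral do rewrite -nneseries_addn ?lee_fin//.
rewrite integral_nneseries//; last first.
  by move=> n; apply/measurable_EFinP; exact: random_variable_norm.
rewrite -[RHS]nneseries_addn; last first.
  by move=> i; rewrite unlock; apply: integral_ge0 => w _; rewrite lee_fin.
by apply: eq_eseriesr => i _; rewrite unlock.
Qed.

Lemma prob_norm_tail_ge z chi (lambda eps : R) :
  (forall n, is_random_variable (z n)) ->
  rate_summable (fun n => 'E_P[fun w => `|z n w|%R]) chi ->
  (0 < lambda)%R -> (0 < eps)%R ->
  P [set w | eps%:E <= norm_tail z (chi (lambda * eps)%R) w] <= lambda%:E.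
Proof.
move=> mz chiP l0 e0.
(* [lambda] is the Markov quotient [lambda * eps / eps] *)
rewrite -[leRHS](congr1 EFin (mulfK (lt0r_neq0 e0) lambda)).
apply: markov_le => //.
- exact: measurable_norm_tail.
- by move=> w; exact: norm_tail_ge0.
- by rewrite integral_norm_tail// ltW// chiP// mulr_gt0.
Qed.

End probability_bounds.

(** * The stochastic iteration *)

Section halpern_mann_process.
Context (R : realType) (d : measure_display) (Omega : measurableType d).
Context (P : probability Omega R) (X : normedModType R).
Hypothesis X_separable : separable X.
Variables (T U : X -> X) (p : X).
Hypotheses (T_nonexpansive : nonexpansive T) (U_nonexpansive : nonexpansive U).
Hypotheses (T_fix : T p = p) (U_fix : U p = p).
Variables (alpha beta : nat -> R).
Hypothesis alpha01 : forall n, 0 <= alpha n <= 1.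
Hypothesis beta01 : forall n, 0 <= beta n <= 1.
Variables (x0 u : Omega -> X) (xi delta x y : nat -> Omega -> X).
Hypotheses (x0_rv : is_random_variable x0) (u_rv : is_random_variable u).
Hypothesis xi_rv : forall n, is_random_variable (xi n).
Hypothesis delta_rv : forall n, is_random_variable (delta n).
Hypothesis x_init : forall w, x 0%N w = x0 w.
Hypothesis y_def : forall n w,
  y n w = (1 - alpha n) *: (T (x n w) + xi n w) + alpha n *: u w.
Hypothesis x_step : forall n w,
  x n.+1 w = (1 - beta n) *: (U (y n w) + delta n w) + beta n *: y n w.

Lemma random_variable_convex_step (S : X -> X) (t : R) (f e g : Omega -> X) :
  nonexpansive S ->
  is_random_variable f -> is_random_variable e -> is_random_variable g ->
  is_random_variable (fun w => (1 - t) *: (S (f w) + e w) + t *: g w).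
Proof.
move=> nS rf re rg; apply: random_variable_lincomb => //.
apply: random_variableD => //; apply: random_variable_comp => //.
exact: nonexpansive_continuous.
Qed.

Lemma random_variable_iterates n :
  is_random_variable (x n) /\ is_random_variable (y n).
Proof.
have ry m : is_random_variable (x m) -> is_random_variable (y m).
  by move=> rx; rewrite (funext (y_def m)); exact: random_variable_convex_step.
suff rx : is_random_variable (x n) by split=> //; exact: ry.
elim: n => [|n IHn]; first by rewrite (funext x_init).
by rewrite (funext (x_step n)); apply: random_variable_convex_step => //; exact: ry.
Qed.

(** An [n]-independent bound on the distances of the iterates and of the anchor
to [p]; the sum of the two initial distances stands in for their maximum, so
that its expectation is the sum of the two given ones. *)
Definition envelope (w : Omega) : \bar R :=
  (`|x0 w - p|%:E + `|u w - p|%:E + norm_tail xi 0 w + norm_tail delta 0 w)%E.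

Lemma envelope_ge0 w : (0 <= envelope w)%E.
Proof. by rewrite !adde_ge0 ?norm_tail_ge0 ?lee_fin. Qed.

Lemma measurable_norm_center (f : Omega -> X) : is_random_variable f ->
  measurable_fun setT (fun w => `|f w - p|%:E).
Proof.
move=> rf; apply/measurable_EFinP; apply: random_variable_norm.
exact: random_variableB (random_variable_cst p).
Qed.

Lemma measurable_envelope : measurable_fun setT envelope.
Proof.
by do 3?[apply: emeasurable_funD]; solve
  [exact: measurable_norm_tail | exact: measurable_norm_center].
Qed.

Lemma expectation_envelope_le (K0 D E : R) :
  ('E_P[fun w => `|x0 w - p|%R] <= K0%:E)%E ->
  ('E_P[fun w => `|u w - p|%R] <= K0%:E)%E ->
  (\sum_(0 <= n <oo) 'E_P[fun w => `|delta n w|%R] <= D%:E)%E ->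
  (\sum_(0 <= n <oo) 'E_P[fun w => `|xi n w|%R] <= E%:E)%E ->
  (\int[P]_w envelope w <= (2 * K0 + D + E)%:E)%E.
Proof.
move=> hx hu hD hE; rewrite unlock in hx hu.
rewrite /envelope !ge0_integralD//; try solve
  [ exact: measurable_norm_tail | exact: measurable_norm_center
  | by move=> w _; rewrite ?adde_ge0 ?norm_tail_ge0 ?lee_fin
  | by do 2?[apply: emeasurable_funD]; solve
    [exact: measurable_norm_tail | exact: measurable_norm_center] ].
rewrite !integral_norm_tail// [2 * K0]mulr_natl mulr2n [_ + D + E]addrAC !EFinD.
by do 3?[apply: leeD].
Qed.

Lemma iterates_envelope (C : R) w n : (envelope w < C%:E)%E ->
  [/\ `|x n w - p| < C, `|y n w - p| < C & `|u w - p| < C].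
Proof.
move=> wC.
have := iterates_bounded T_nonexpansive U_nonexpansive T_fix U_fix alpha01
  beta01 (y_def ^~ w) (x_step ^~ w) (B := `|x0 w - p| + `|u w - p|) n.
rewrite /= x_init lerDl lerDr !normr_ge0 => /(_ isT isT) [xB yB].
have sxi := norm_tail_ge_sum xi n.+1 w.
have sxi' := norm_tail_ge_sum xi n w.
have sde := norm_tail_ge_sum delta n w.
split; rewrite -lte_fin; apply: le_lt_trans wC; rewrite /envelope.
- rewrite -lee_fin in xB; apply: (le_trans xB).
  by rewrite !EFinD; do 2?[apply: leeD].
- rewrite -lee_fin in yB; apply: (le_trans yB).
  by rewrite !EFinD; do 2?[apply: leeD].
- rewrite -addeA -[leLHS]adde0 leeD ?adde_ge0 ?norm_tail_ge0//.
  by rewrite -EFinD lee_fin lerDr.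
Qed.

End halpern_mann_process.

Theorem theorem3p12 (R : realType) (d : measure_display)
  (Omega : measurableType d) (P : probability Omega R)
  (X : normedModType R) (X_separable : separable X)
  (eta : R -> R) (X_unif_convex : modulus_of_uniform_convexity X eta)
  (T U : X -> X) (T_nonexpansive : nonexpansive T)
  (U_nonexpansive : nonexpansive U)
  (x0 u : Omega -> X) (xi delta : nat -> Omega -> X)
  (x0_rv : is_random_variable x0) (u_rv : is_random_variable u)
  (xi_rv : forall n, is_random_variable (xi n))
  (delta_rv : forall n, is_random_variable (delta n))
  (alpha beta : nat -> R)
  (alpha01 : forall n, 0 <= alpha n <= 1)
  (beta01 : forall n, 0 <= beta n <= 1)
  (x y : nat -> Omega -> X)
  (x_init : forall w, x 0%N w = x0 w)
  (y_def : forall n w,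
    y n w = (1 - alpha n) *: (T (x n w) + xi n w) + alpha n *: u w)
  (x_step : forall n w,
    x n.+1 w = (1 - beta n) *: (U (y n w) + delta n w) + beta n *: y n w)
  (p : X) (T_fix : T p = p) (U_fix : U p = p)
  (K0 D E : R)
  (K0_x0 : ('E_P[fun w => `|x0 w - p|%R] <= K0%:E)%E)
  (K0_u : ('E_P[fun w => `|u w - p|%R] <= K0%:E)%E)
  (D_delta : (\sum_(0 <= n <oo) 'E_P[fun w => `|delta n w|%R] <= D%:E)%E)
  (E_xi : (\sum_(0 <= n <oo) 'E_P[fun w => `|xi n w|%R] <= E%:E)%E)
  (Delta : R -> R -> nat)
  (Delta_rate : rate_as_to0 P (fun n w => `|x n.+1 w - x n w|) Delta)
  (rho : R -> nat) (rho_rate : rate_to0 alpha rho)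
  (chi1 chi2 : R -> nat)
  (xi_summable : (\sum_(0 <= n <oo) 'E_P[fun w => `|xi n w|%R] < +oo)%E)
  (chi1_rate : rate_summable (fun n => 'E_P[fun w => `|xi n w|%R])%E chi1)
  (delta_summable :
    (\sum_(0 <= n <oo) 'E_P[fun w => `|delta n w|%R] < +oo)%E)
  (chi2_rate : rate_summable (fun n => 'E_P[fun w => `|delta n w|%R])%E chi2)
  (Lambda : R) (Lambda_gt0 : 0 < Lambda)
  (beta_Lambda : forall n, Lambda <= beta n <= 1 - Lambda) :
  let K := 4 * K0 + 2 * D + 2 * E in
  let K' := fun lambda : R => 3 * K / lambda in
  let eps_hat := fun lambda eps : R =>
    eps * Lambda ^+ 2 * eta (eps / K' lambda) in
  let Gamma := fun lambda eps : R =>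
    maxn (Delta (lambda / 9) (eps_hat lambda eps / 4))
      (maxn (rho (eps_hat lambda eps / (4 * K' lambda)))
        (maxn (chi1 (lambda * eps_hat lambda eps / 36))
          (chi2 (lambda * eps_hat lambda eps / 36)))) in
  rate_as_to0 P (fun n w => `|U (y n w) - y n w|) Gamma.
Proof.
move=> K K' eps_hat Gamma lambda eps l0 e0.
have rvx n : is_random_variable (x n).
  by have [] := random_variable_iterates X_separable T_nonexpansive
    U_nonexpansive x0_rv u_rv xi_rv delta_rv x_init y_def x_step n.
have rvy n : is_random_variable (y n).
  by have [] := random_variable_iterates X_separable T_nonexpansive
    U_nonexpansive x0_rv u_rv xi_rv delta_rv x_init y_def x_step n.
have rvU n : is_random_variable (fun w => U (y n w) - y n w).
  apply: random_variableB => //; apply: random_variable_comp => //.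
  exact: nonexpansive_continuous.
set N := Gamma lambda eps.
set bad := [set w | exists n : nat, (N <= n)%N /\ eps <= `|U (y n w) - y n w|].
have mbad : measurable bad.
  by apply: measurable_eventually_ge => n; exact: random_variable_norm.
pose M := envelope p x0 u xi delta.
have mM : measurable_fun setT M by exact: measurable_envelope.
have EM : (\int[P]_w M w <= (K / 2)%:E)%E.
  have -> : K / 2 = 2 * K0 + D + E by rewrite /K; lra.
  exact: expectation_envelope_le.
have PM (c : R) : 0 < c -> (P [set w | c%:E <= M w] <= (K / 2 / c)%:E)%E.
  by move=> c0; apply: markov_le => // w; exact: envelope_ge0.
have bound (c : R) w n : (M w < c%:E)%E ->
    [/\ `|x n w - p| < c, `|y n w - p| < c & `|u w - p| < c].
  by move=> Mc; exact: (iterates_envelope T_nonexpansive U_nonexpansive T_fix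
    U_fix alpha01 beta01 x_init y_def x_step n Mc).
have [K_small|K_large] := ltP K (lambda * eps).
  (* [K' = 0] and [eps / K' > 2] fall in this case, where nothing is known of
     [eta (eps / K')] *)
  have half : 0 < eps / 2 by rewrite divr_gt0.
  have sub : bad `<=` [set w | (eps / 2)%:E <= M w]%E.
    move=> w [n [_ eU]] /=; rewrite leNgt; apply/negP => /(bound _ _ n)[_ yM _].
    have := nonexpansive_fix_le (y n w) U_nonexpansive U_fix.
    have := ler_normB (U (y n w) - p) (y n w - p).
    rewrite opprB addrA subrK => UyB Uyp; clear -eU yM UyB Uyp; lra.
  apply: le_lt_trans (le_measure _ _ _ sub) _; rewrite ?inE//.
    exact: measurable_ereal_ge.
  apply: le_lt_trans (PM _ half) _; rewrite lte_fin.
  by rewrite -mulf_div divff// mulr1 ltr_pdivrMr.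
have K_gt0 : 0 < K by apply: lt_le_trans K_large; rewrite mulr_gt0.
have K'_gt0 : 0 < K' lambda by rewrite divr_gt0// mulr_gt0.
have epsK' : 0 < eps / K' lambda <= 2.
  rewrite divr_gt0//= ler_pdivrMr// /K' mulrA ler_pdivlMr//; lra.
have [/andP[eta0 _] _] := X_unif_convex _ epsK'.
set eh := eps_hat lambda eps.
have eh0 : 0 < eh by rewrite !mulr_gt0 ?exprn_gt0.
have eh4 : 0 < eh / 4 by rewrite divr_gt0.
have l9 : 0 < lambda / 9 by rewrite divr_gt0.
pose A1 := [set w | (K' lambda)%:E <= M w]%E.
pose A2 := [set w | exists n : nat, (Delta (lambda / 9) (eh / 4) <= n)%N /\
  eh / 4 <= `|x n.+1 w - x n w|].
pose A3 := [set w | (eh / 4)%:E <= norm_tail xi (chi1 (lambda * eh / 36)%R) w]%E.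
pose A4 := [set w | (eh / 4)%:E <= norm_tail delta (chi2 (lambda * eh / 36)%R) w]%E.
have mA1 : measurable A1 by exact: measurable_ereal_ge.
have mA2 : measurable A2.
  apply: measurable_eventually_ge => n; apply: random_variable_norm.
  exact: random_variableB.
have mA3 : measurable A3.
  by apply: measurable_ereal_ge; exact: measurable_norm_tail.
have mA4 : measurable A4.
  by apply: measurable_ereal_ge; exact: measurable_norm_tail.
have PA1 : (P A1 <= (lambda / 6)%:E)%E.
  apply: le_trans (PM _ K'_gt0) _; rewrite lee_fin ler_pdivrMr// /K'.
  by rewrite [lambda / 6 * _]mulrC mulrA divfK ?gt_eqF//; lra.
have PA2 : (P A2 < (lambda / 9)%:E)%E by exact: Delta_rate.
have chiE : lambda * eh / 36 = lambda / 9 * (eh / 4) by lra.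
have PA3 : (P A3 <= (lambda / 9)%:E)%E.
  by rewrite /A3 chiE; exact: prob_norm_tail_ge.
have PA4 : (P A4 <= (lambda / 9)%:E)%E.
  by rewrite /A4 chiE; exact: prob_norm_tail_ge.
have sub : bad `<=` A1 `|` A2 `|` A3 `|` A4.
  move=> w [n [Nn eU]]; apply: contrapT => /not_orP[/not_orP[/not_orP[]]].
  move=> /negP; rewrite -ltNge => /(bound _ _ n)[_ yM uM] nA2.
  move=> /negP; rewrite -ltNge => xiM /negP; rewrite -ltNge => deM.
  move: Nn; rewrite /N /Gamma !geq_max => /and4P[N1 N2 N3 N4].
  suff : `|U (y n w) - y n w| < eps by rewrite ltNge eU.
  apply: (@residual_lt _ _ T U p T_nonexpansive U_nonexpansive T_fix U_fix alpha
    beta (u w) (xi ^~ w) (delta ^~ w) (x ^~ w) (y ^~ w) alpha01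
    (y_def ^~ w) (x_step ^~ w) eta Lambda eps (K' lambda) eh) => //.
  - by case/andP: epsK'.
  - exact: ltW.
  - exact: ltW.
  - rewrite ltNge; apply/negP => dx; apply: nA2; exists n; split=> //.
  - apply: rho_rate N2; exact: divr_gt0 eh0 (mulr_gt0 _ K'_gt0).
  - by rewrite -lte_fin; apply: le_lt_trans xiM; exact: norm_tail_ge.
  - by rewrite -lte_fin; apply: le_lt_trans deM; exact: norm_tail_ge.
apply: le_lt_trans (le_measure _ _ _ sub) _; rewrite ?inE//.
  by do 3?[apply: measurableU].
apply: (@le_lt_trans _ _ (P A1 + P A2 + P A3 + P A4)%E).
  apply: le_trans (measureU2 _ _ _) _ => //; first by do 2?[apply: measurableU].
  apply: leeD => //; apply: le_trans (measureU2 _ _ _) _ => //.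
    exact: measurableU.
  by apply: leeD => //; exact: measureU2.
apply: (@le_lt_trans _ _ (lambda / 6 + lambda / 9 + lambda / 9 + lambda / 9)%:E).
  by rewrite !EFinD; do 3?[apply: leeD] => //; exact: ltW.
by rewrite lte_fin; lra.
Qed.
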